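(* Let $p$ be a prime number and $n$ a positive integer such that $p$ does not divide $n$ and each group of order $np$ has a normal subgroup of order $p$. Let $E$ be a group of order $n$ and $N=\mathbf{Z}_p\times E$. Let $F$ be a regular subgroup of $\mathrm{Hol}(E)$ and $\tau:F\to\mathbf{Z}_p^*$ a group morphism. Let $G=\{((m,\tau(f)),f)\mid m\in\mathbf{Z}_p,\ f\in F\}\subseteq(\mathbf{Z}_p\rtimes\mathbf{Z}_p^* )\times\mathrm{Hol}(E)=\mathrm{Hol}(N)$ be the regular subgroup of $\mathrm{Hol}(N)$ corresponding to $(F,\tau)$. Then the length of the conjugacy class of $G$ in $\mathrm{Hol}(N)$ is equal to the length of the conjugacy class of $F$ in $\mathrm{Hol}(E)$ times the number of group morphisms $\tau':F\to\mathbf{Z}_p^*$ with $\tau'\simeq\tau$, where $\tau\simeq\tau'$ if and only if $\tau=\tau'\circ\Phi_\nu|_F$ for some $\nu\in\mathrm{Aut}(E)$ with $\Phi_\nu(F)=F$.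
   Context: $\mathbf{Z}_p=\mathbf{Z}/p\mathbf{Z}$, with $\mathrm{Aut}(\mathbf{Z}_p)$ identified with $\mathbf{Z}_p^*$. For a group $N$, $\mathrm{Hol}(N)=N\rtimes\mathrm{Aut}(N)$, with product $(x,\varphi)(y,\psi)=(x\varphi(y),\varphi\psi)$, acting on $N$ by $(x,\varphi)\cdot y=x\varphi(y)$. A subgroup of $\mathrm{Hol}(N)$ is regular if it acts regularly (transitively with trivial stabilizers) on $N$. For $\nu\in\mathrm{Aut}(E)\subseteq\mathrm{Hol}(E)$, $\Phi_\nu(a,\sigma)=(\nu(a),\nu\sigma\nu^{-1})$ is the inner automorphism of $\mathrm{Hol}(E)$ given by conjugation by $\nu$. The length of a conjugacy class of subgroups is the number of subgroups in it. *)

(* Defs.v *)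
From HB Require Import structures.
From mathcomp Require Import all_boot all_order all_algebra all_fingroup.

Set Implicit Arguments.
Unset Strict Implicit.
Unset Printing Implicit Defensive.

Import GroupScope.

Notation auto gT := (subg_of [Aut [set: gT]]%G) (only parsing).

Definition aut_fun (gT : finGroupType) (phi : auto gT) : gT -> gT :=
  fun x => (sgval phi : {perm gT}) x.

Section AutFun.

Variable gT : finGroupType.
Implicit Types (phi psi : auto gT) (x y : gT).

Lemma aut_funM phi x y : aut_fun phi (x * y) = aut_fun phi x * aut_fun phi y.
Proof.
by have /Aut_morphic/morphicP := subgP phi; apply; rewrite inE.
Qed.

Lemma aut_fun1 x : aut_fun 1 x = x.
Proof. by rewrite /aut_fun perm1. Qed.

Lemma aut_fun_mul phi psi x : aut_fun (phi * psi) x = aut_fun psi (aut_fun phi x).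
Proof. by rewrite /aut_fun /= permM. Qed.

Lemma aut_fun_inj phi : injective (aut_fun phi).
Proof. exact: perm_inj. Qed.

Lemma eq_aut phi psi : aut_fun phi =1 aut_fun psi -> phi = psi.
Proof. by move=> e; apply: val_inj; apply/permP. Qed.

Lemma mk_aut_subproof (h : gT -> gT) (inj_h : injective h)
  (hM : {morph h : x y / x * y}) : perm inj_h \in [Aut [set: gT]]%G.
Proof.
rewrite inE; apply/andP; split; first by apply/subsetP=> x; rewrite !inE.
by apply/morphicP=> x y _ _; rewrite !permE hM.
Qed.

Definition mk_aut (h : gT -> gT) (inj_h : injective h)
    (hM : {morph h : x y / x * y}) : auto gT :=
  Subg (mk_aut_subproof inj_h hM).

Lemma mk_autE h inj_h hM x : aut_fun (@mk_aut h inj_h hM) x = h x.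
Proof. by rewrite /aut_fun permE. Qed.

End AutFun.

(* A record rather than a pair, so that it does not inherit the group law of  *)
(* the direct product.                                                        *)
Record hol (gT : finGroupType) := Hol { htr : gT; haut : auto gT }.

Section Holomorph.

Variable gT : finGroupType.

Let hol_pair (g : hol gT) := (htr g, haut g).
Let pair_hol u : hol gT := Hol u.1 u.2.
Let hol_pairK : cancel hol_pair pair_hol. Proof. by case. Qed.
HB.instance Definition _ := Finite.copy (hol gT) (can_type hol_pairK).

(* The product is (x, phi)(y, psi) = (x phi(y), phi o psi); permutations      *)
(* compose from left to right in MathComp, so phi o psi is psi * phi.         *)
Definition hol_mul (g h : hol gT) : hol gT :=
  Hol (htr g * aut_fun (haut g) (htr h)) (haut h * haut g).
Definition hol_one : hol gT := Hol 1 1.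
Definition hol_inv (g : hol gT) : hol gT :=
  Hol (aut_fun (haut g)^-1 (htr g)^-1) (haut g)^-1.

Let hol_mulA : associative hol_mul.
Proof.
by move=> [x f] [y g] [z h]; rewrite /hol_mul /= aut_funM aut_fun_mul !mulgA.
Qed.
Let hol_mul1 : left_id hol_one hol_mul.
Proof. by case=> x f; rewrite /hol_mul /= aut_fun1 mul1g mulg1. Qed.
Let hol_mulV : left_inverse hol_one hol_inv hol_mul.
Proof.
case=> x f; rewrite /hol_mul /= -aut_funM mulVg mulgV.
by congr Hol; apply: (@mulgI _ (aut_fun f^-1 1)); rewrite -aut_funM !mulg1.
Qed.
HB.instance Definition _ :=
  Finite_isGroup.Build (hol gT) hol_mulA hol_mul1 hol_mulV.

Definition hol_act (g : hol gT) (y : gT) : gT := htr g * aut_fun (haut g) y.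

Lemma hol_act1 y : hol_act 1 y = y.
Proof. by rewrite /hol_act /= aut_fun1 mul1g. Qed.

Lemma hol_actM g h y : hol_act (g * h) y = hol_act g (hol_act h y).
Proof. by rewrite /hol_act /= aut_fun_mul aut_funM mulgA. Qed.

Definition hol_regular (F : {set hol gT}) : Prop :=
  (forall y z, exists2 g, g \in F & hol_act g y = z) /\
  (forall y g, g \in F -> hol_act g y = y -> g = 1).

(* The automorphism part is nu o sigma o nu^-1, again written from left to    *)
(* right.                                                                     *)
Definition Phi (nu : auto gT) (g : hol gT) : hol gT :=
  Hol (aut_fun nu (htr g)) (nu^-1 * haut g * nu).

Lemma PhiE nu g : Phi nu g = Hol 1 nu * g * (Hol 1 nu)^-1.
Proof.
rewrite /Phi [RHS]/mulg /= /hol_mul /= mul1g mulgA; congr Hol.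
have e1 (phi : auto gT) : aut_fun phi 1 = 1.
  by apply: (@mulgI _ (aut_fun phi 1)); rewrite -aut_funM !mulg1.
by rewrite invg1 !e1 mulg1.
Qed.

End Holomorph.

(* The finite type of group morphisms from the subgroup F to rT.              *)
Record ghom (aT rT : finGroupType) (F : {group aT}) := Ghom {
  ghom_ffun :> {ffun subg_of F -> rT};
  _ : morphic [set: subg_of F] ghom_ffun
}.
Arguments ghom {aT} rT F.

HB.instance Definition _ (aT rT : finGroupType) (F : {group aT}) :=
  [isSub of ghom rT F for @ghom_ffun aT rT F].
HB.instance Definition _ (aT rT : finGroupType) (F : {group aT}) :=
  [Finite of ghom rT F by <:].

Lemma ghomM (aT rT : finGroupType) (F : {group aT}) (t : ghom rT F) :
  {morph t : x y / x * y}.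
Proof. by move=> x y; have /morphicP-> := valP t; rewrite ?inE. Qed.

(* tau = tau' o Phi_nu|_F for some automorphism nu with Phi_nu(F) = F; since  *)
(* Phi_nu maps F to itself, the projection subg F leaves Phi_nu(f) unchanged. *)
Definition ghom_simeq (gT rT : finGroupType) (F : {group hol gT})
    (tau tau' : ghom rT F) : bool :=
  [exists nu : auto gT,
    (Phi nu @: F == F :> {set hol gT}) &&
    [forall f : subg_of F, tau f == tau' (subg F (Phi nu (sgval f)))]].

Section Product.

(* For p prime, 'Z_p is Z/pZ; its group law is the addition.                  *)
Variables (p : nat) (gT : finGroupType).

Definition prod_aut_fun (u : {unit 'Z_p}) (phi : auto gT) (ky : 'Z_p * gT) :
  'Z_p * gT := ((val u * ky.1)%R, aut_fun phi ky.2).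

Lemma prod_aut_fun_inj u phi : injective (prod_aut_fun u phi).
Proof.
move=> [k y] [k' y'] [e1 e2]; rewrite (aut_fun_inj e2); congr (_, _).
by apply: (GRing.mulrI (valP u)); apply: val_inj.
Qed.

Lemma prod_aut_funM u phi : {morph prod_aut_fun u phi : x y / x * y}.
Proof.
by move=> [k y] [k' y']; congr (_, _); [apply: GRing.mulrDr | apply: aut_funM].
Qed.

Definition prod_aut (u : {unit 'Z_p}) (phi : auto gT) : auto ('Z_p * gT)%type :=
  mk_aut (@prod_aut_fun_inj u phi) (@prod_aut_funM u phi).

(* The embedding of (Z_p >| Z_p^* ) x Hol(E) in Hol(Z_p x E), acting          *)
(* componentwise; it is the identification of both groups when p is coprime   *)
(* to #|E|.                                                                   *)
Definition hol_prod (m : 'Z_p) (u : {unit 'Z_p}) (g : hol gT) :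
    hol ('Z_p * gT)%type :=
  Hol (m, htr g) (prod_aut u (haut g)).

Lemma hol_act_prod m u g k y :
  hol_act (hol_prod m u g) (k, y) = ((m + val u * k)%R, hol_act g y).
Proof. by rewrite /hol_act /= mk_autE. Qed.

Lemma hol_prodM m u g m' u' g' :
  hol_prod m u g * hol_prod m' u' g' =
  hol_prod (m + val u * m')%R (u * u') (g * g').
Proof.
rewrite [LHS]/mulg /= /hol_mul /= mk_autE; congr Hol.
apply: eq_aut => -[k y]; rewrite aut_fun_mul !mk_autE; congr (_, _) => /=.
  by rewrite GRing.mulrA.
by rewrite aut_fun_mul.
Qed.

Variables (F : {group hol gT}) (tau : ghom {unit 'Z_p} F).

Definition lift_set : {set hol ('Z_p * gT)%type} :=
  [set hol_prod m (tau f) (sgval f) | m : 'Z_p, f : subg_of F].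

Lemma lift_group_set : group_set lift_set.
Proof.
have t1 : tau 1 = 1 by apply: (mulgI (tau 1)); rewrite -ghomM !mulg1.
apply/group_setP; split.
  apply/imset2P; exists (0%R : 'Z_p) (1 : subg_of F); rewrite ?inE //.
  congr Hol; apply: eq_aut => -[k y]; rewrite t1 aut_fun1 mk_autE.
  by congr (_, _); rewrite ?GRing.mul1r ?aut_fun1.
move=> _ _ /imset2P[m f _ _ ->] /imset2P[m' f' _ _ ->].
rewrite hol_prodM -ghomM; apply/imset2P.
by exists (m + val (tau f) * m')%R (f * f'); rewrite ?inE.
Qed.

Canonical lift_group := Group lift_group_set.

Lemma lift_regular : hol_regular F -> hol_regular lift_group.
Proof.
case=> trF stF; split=> [[k y] [l z] | [k y] _ /imset2P[m f _ _ ->]].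
  have [g Fg gy] := trF y z; pose f := subg F g.
  exists (hol_prod (l - val (tau f) * k)%R (tau f) (sgval f)).
    by apply/imset2P; eexists; rewrite ?inE //.
  by rewrite hol_act_prod GRing.subrK subgK ?gy.
rewrite hol_act_prod => -[+ /(stF _ _ (subgP f)) f1].
have -> : f = 1 by apply: val_inj.
have -> : tau 1 = 1 by apply: (mulgI (tau 1)); rewrite -ghomM !mulg1.
rewrite GRing.mul1r -[in RHS](GRing.add0r k) => /GRing.addIr->.
congr Hol; apply: eq_aut => -[k' y']; rewrite aut_fun1 mk_autE.
by congr (_, _); rewrite ?GRing.mul1r ?aut_fun1.
Qed.

End Product.

(* Main.v *)
Require Import Defs.
From mathcomp Require Import all_boot all_order all_algebra all_fingroup.
From mathcomp Require Import cyclic.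

Set Implicit Arguments.
Unset Strict Implicit.

Import GroupScope.

(** The holomorph of [E] embeds in that of [N = Z_p * E] as the elements
    [hol_prod 0 1 g]; let [H] be this copy of [Hol(E)] and [G] the group
    [lift_group tau].  Each of the three numbers counts the conjugates of a
    group under [H], under [Hol(E)] or under a subgroup of [H], hence is an
    index, and the product formula is the multiplicativity of indices.

    - As [p] does not divide [#|E|], an automorphism of [N] preserves both
      factors, hence every element of [Hol(N)] is some [hol_prod m u g]
      ([hol_prod_surj]).  The elements [hol_prod m u 1] normalise [G]
      ([hol_prod1_norm_lift]), so the conjugates of [G] in [Hol(N)] are already
      its conjugates under [H] ([lift_class]): there are [#|H : 'N_H(G)|].

    - Conjugating [G] by the copy of [g] conjugates [F] by [g], so ['N_H(G)]
      lies in the copy [M] of ['N(F)] ([norm_lift_sub]).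

    - Modulo [F], every element of ['N(F)] is an automorphism [nu] of [E] with
      [Phi nu @: F = F], because [F] is transitive ([transitive_factor]); the
      copy of [F] itself normalises [G].  Conjugating [G] by such a [nu] replaces
      [tau] by [tau o Phi_nu] ([lift_conj_aut]); so the conjugates of [G] under
      [M] are the lifts of the morphisms [tau' ~ tau] ([lift_norm_class]), and
      their number is [#|M : 'N_M(G)| = #|M : 'N_H(G)|].

    As [#|H : M| = #|Hol(E) : 'N(F)|] is the number of conjugates of [F], the
    identity [#|H : M| * #|M : 'N_H(G)| = #|H : 'N_H(G)|] is the claim. *)

(** * Torsion in finite groups *)

Lemma coprime_torsion (gT : finGroupType) (x : gT) i j :
  coprime i j -> x ^+ i = 1 -> x ^+ j = 1 -> x = 1.
Proof.
move=> /eqP co /eqP xi /eqP xj; apply/eqP.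
by rewrite -order_eq1 -dvdn1 -co dvdn_gcd !order_dvdn xi.
Qed.

Lemma card_torsion (gT : finGroupType) (x : gT) : x ^+ #|[set: gT]| = 1.
Proof. by apply: expg_cardG; rewrite inE. Qed.

(** * Holomorphs *)

Section Holomorph.

Variable gT : finGroupType.
Implicit Types (g : hol gT) (nu : auto gT).

Lemma aut_fun_1 nu : aut_fun nu 1 = 1.
Proof. by apply: (mulgI (aut_fun nu 1)); rewrite -aut_funM !mulg1. Qed.

Lemma aut_funX nu x i : aut_fun nu (x ^+ i) = aut_fun nu x ^+ i.
Proof. by elim: i => [|i IHi]; rewrite ?aut_fun_1 // !expgS aut_funM IHi. Qed.

Lemma hol_act_faithful g g' : hol_act g =1 hol_act g' -> g = g'.
Proof.
move=> e; have e1 : htr g = htr g'.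
  by have := e 1; rewrite /hol_act !aut_fun_1 !mulg1.
case: g g' e1 e => [x nu] [x' nu'] /= <- e; congr Hol.
by apply: eq_aut => y; apply: (mulgI x); apply: e.
Qed.

Lemma Phi_conjg nu g : Phi nu (g ^ Hol 1 nu) = g.
Proof. by rewrite PhiE conjgE !mulgA mulgV mul1g mulgK. Qed.

Lemma conjg_Phi nu g : Phi nu g ^ Hol 1 nu = g.
Proof. by rewrite PhiE conjgE !mulgA mulVg mul1g mulgKV. Qed.

Lemma PhiM nu g h : Phi nu (g * h) = Phi nu g * Phi nu h.
Proof. by rewrite !PhiE !mulgA mulgKV. Qed.

Lemma Phi_norm nu (F : {group hol gT}) :
  (Phi nu @: F == F :> {set _}) = (Hol 1 nu \in 'N(F)).
Proof.
rewrite -groupV; have -> : Phi nu @: F = F :^ (Hol 1 nu)^-1.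
  by apply: eq_imset => g; rewrite PhiE conjgE invgK mulgA.
by apply/eqP/normP.
Qed.

(** Being transitive, [F] contains an element with the same value at [1] as
    [g], and the stabiliser of [1] is the automorphism group. *)
Lemma transitive_factor (F : {group hol gT}) (F_regular : hol_regular F) g :
  exists2 f, f \in F & exists nu, g = f * Hol 1 nu.
Proof.
have [f Ff f1] := F_regular.1 1 (hol_act g 1).
exists f => //; exists (haut (f^-1 * g)).
suff <- : f^-1 * g = Hol 1 (haut (f^-1 * g)) by rewrite mulKVg.
have : hol_act (f^-1 * g) 1 = 1 by rewrite hol_actM -f1 -hol_actM mulVg hol_act1.
by case: (f^-1 * g) => x nu; rewrite /hol_act /= aut_fun_1 mulg1 => ->.
Qed.

End Holomorph.

(** * The holomorph of a product of coprime orders *)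

Section ProductHolomorph.

Variables (p : nat) (E : finGroupType).
Implicit Types (m : 'Z_p) (u : {unit 'Z_p}) (g : hol E).

Lemma hol_prod_inj m u g m' u' g' :
  hol_prod m u g = hol_prod m' u' g' -> [/\ m = m', u = u' & g = g'].
Proof.
move=> e; have {}e k y : (m + val u * k, hol_act g y)%R =
                         (m' + val u' * k, hol_act g' y)%R.
  by rewrite -!hol_act_prod e.
have em : m = m'.
  by have := congr1 fst (e 0%R 1); rewrite /= !GRing.mulr0 !GRing.addr0.
split=> //; last by apply: hol_act_faithful => y; case: (e 0%R y).
apply: val_inj; have := congr1 fst (e 1%R 1).
by rewrite /= !GRing.mulr1 em => /GRing.addrI.
Qed.

Definition hol_embed g : hol ('Z_p * E)%type := hol_prod 0%R 1 g.

Lemma hol_embedM : {in [set: hol E] &, {morph hol_embed : g h / g * h}}.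
Proof.
by move=> g h _ _; rewrite /hol_embed hol_prodM GRing.mulr0 GRing.addr0 mulg1.
Qed.
Canonical hol_embed_morphism := Morphism hol_embedM.

Lemma injm_hol_embed : 'injm hol_embed.
Proof. by apply/injmP => g h _ _ /hol_prod_inj[]. Qed.

Lemma hol_prod_split m u g :
  hol_prod m u g = hol_prod m u 1 * hol_embed g.
Proof. by rewrite hol_prodM GRing.mulr0 GRing.addr0 mulg1 mul1g. Qed.

Lemma hol_prod_embedJ m u g h :
  hol_prod m u g ^ hol_embed h = hol_prod m u (g ^ h).
Proof.
rewrite conjgE -morphV ?inE //= !hol_prodM mul1g mulg1 conjgE.
by rewrite GRing.mul1r GRing.mulr0 GRing.addr0 GRing.add0r mulgA.
Qed.

Hypothesis p_prime : prime p.
Hypothesis pE : ~~ (p %| #|[set: E]|)%N.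

Lemma Zp_prime_unit (k : 'Z_p) : k != 0%R -> k \is a GRing.unit.
Proof.
have p_gt1 := prime_gt1 p_prime.
rewrite -{2}[k]natr_Zp unitZpE // prime_coprime // => k0.
have k_gt0 : (0 < k)%N by rewrite lt0n.
by apply/negP => /(dvdn_leq k_gt0); rewrite leqNgt -{2}(Zp_cast p_gt1) ltn_ord.
Qed.

Lemma pair_expg (k : 'Z_p) (y : E) i : (k, y) ^+ i = ((k *+ i)%R, y ^+ i).
Proof. by elim: i => // i IHi; rewrite !expgS IHi GRing.mulrS. Qed.

Lemma expg_fst (x : 'Z_p * E) i : (x ^+ i).1 = (x.1 *+ i)%R.
Proof. by case: x => k y; rewrite pair_expg. Qed.

Lemma expg_snd (x : 'Z_p * E) i : (x ^+ i).2 = x.2 ^+ i.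
Proof. by case: x => k y; rewrite pair_expg. Qed.

Lemma Zp_torsion (k : 'Z_p) : (k *+ p = 0)%R.
Proof. by rewrite -GRing.mulr_natl pchar_Zp ?prime_gt1 // GRing.mul0r. Qed.

(** An element of [Z_p * E] killed by [p] lies in the first factor and one
    killed by [#|E|] in the second, so an automorphism preserves both factors;
    on [Z_p] it is the multiplication by the image of [1]. *)
Lemma prod_aut_surj (phi : auto ('Z_p * E)%type) :
  exists u nu, phi = prod_aut u nu.
Proof.
have co : coprime p #|[set: E]| by rewrite prime_coprime.
pose a k := aut_fun phi (k, 1); pose b y := aut_fun phi (0%R : 'Z_p, y).
have aX k i : a (k *+ i)%R = a k ^+ i by rewrite -aut_funX pair_expg expg1n.
have bX y i : b (y ^+ i) = b y ^+ i by rewrite -aut_funX pair_expg GRing.mul0rn.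
have aE k : a k = ((k * (a 1%R).1)%R, 1).
  rewrite [LHS]surjective_pairing; congr (_, _).
    by rewrite -{1}(natr_Zp k) aX expg_fst -GRing.mulr_natl natr_Zp.
  apply: (coprime_torsion co); last exact: card_torsion.
  by rewrite -expg_snd -aX Zp_torsion /a aut_fun_1.
have bE y : b y = (0%R, (b y).2).
  rewrite [LHS]surjective_pairing; congr (_, _).
  apply: (coprime_torsion co); rewrite FinRing.zmodXgE; first exact: Zp_torsion.
  by rewrite -expg_fst -bX card_torsion /b aut_fun_1.
have u_unit : (a 1%R).1 \is a GRing.unit.
  apply: Zp_prime_unit; apply/eqP => a1; have := aE 1%R.
  rewrite a1 GRing.mulr0 -[RHS](aut_fun_1 phi) => /aut_fun_inj[].
  by move/eqP; rewrite GRing.oner_eq0.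
have b_inj : injective (fun y => (b y).2).
  by move=> y z e; have := bE y; rewrite e -bE => /aut_fun_inj[].
have bM : {morph (fun y => (b y).2) : y z / y * z}.
  move=> y z; rewrite -[RHS]/((b y * b z).2) -aut_funM; congr (aut_fun _ (_, _)).2.
  exact: esym (GRing.addr0 _).
exists (FinRing.Unit u_unit), (mk_aut b_inj bM); apply: eq_aut => -[k y].
rewrite mk_autE /prod_aut_fun /= mk_autE.
have -> : (k, y) = (k, 1) * (0%R, y).
  by congr (_, _); rewrite ?mul1g // [RHS]GRing.addr0.
rewrite aut_funM -/(a k) -/(b y) aE bE; congr (_, _) => /=.
  by rewrite [LHS]GRing.addr0 GRing.mulrC.
by rewrite mul1g.
Qed.

Lemma hol_prod_surj (h : hol ('Z_p * E)%type) : exists m u g, h = hol_prod m u g.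
Proof.
case: h => [[m x] phi]; have [u [nu ->]] := prod_aut_surj phi.
by exists m, u, (Hol x nu).
Qed.

End ProductHolomorph.

Arguments hol_embed p {E} g.

(** * Conjugates of a lifted group *)

Section Lift.

Variables (p : nat) (E : finGroupType) (F : {group hol E}).
Implicit Types (tau : ghom {unit 'Z_p} F) (m : 'Z_p) (u : {unit 'Z_p}).
Implicit Types (nu : auto E) (g : hol E).

Local Notation H := (hol_embed p @* [set: hol E]).

Lemma liftP tau x :
  reflect (exists m (f : subg_of F), x = hol_prod m (tau f) (sgval f))
          (x \in lift_group tau).
Proof.
apply: (iffP imset2P) => [[m f _ _ ->] | [m [f ->]]]; first by exists m, f.
by exists m f.
Qed.

Lemma lift_inj : injective (fun tau => lift_group tau : {set _}).
Proof.
move=> tau tau' e; apply/val_inj/ffunP => f.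
have : hol_prod 0%R (tau f) (sgval f) \in lift_group tau.
  by apply/liftP; exists 0%R, f.
rewrite e => /liftP[m [f' /hol_prod_inj[_ -> ff']]].
by congr (tau' _); apply: val_inj.
Qed.

(** In the first factor the lift contains all the translations above each
    [f], and conjugation changes the translation part but not the unit [tau f],
    because the units of [Z_p] commute. *)
Lemma hol_prod1_norm_lift tau m u :
  hol_prod m u (1 : hol E) \in 'N(lift_group tau).
Proof.
apply/normP/eqP; rewrite eqEcard cardJg leqnn andbT.
apply/subsetP => _ /imsetP[x /liftP[k [f ->]] ->].
set c := hol_prod m _ _.
pose k' := ((val u)^-1 * (k + val (tau f) * m - m))%R.
suff -> : hol_prod k (tau f) (sgval f) ^ c = hol_prod k' (tau f) (sgval f).
  by apply/liftP; exists k', f.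
(* [k'] solves [m + u k' = k + tau(f) m], the equation that compares the      *)
(* translation parts.                                                         *)
apply: (mulgI c); rewrite -conjgC !hol_prodM mulg1 mul1g.
have -> : tau f * u = u * tau f by apply: val_inj; apply: GRing.mulrC.
congr hol_prod; rewrite /k' GRing.mulrA GRing.mulrV ?(valP u) //.
by rewrite GRing.mul1r [RHS]GRing.addrC GRing.subrK.
Qed.

(** The copy of [g] differs from the element [hol_prod 0 (tau g) g] of the
    lift by a factor [hol_prod 0 (tau g) 1], which normalises the lift. *)
Lemma hol_embed_norm_lift tau g : g \in F -> hol_embed p g \in 'N(lift_group tau).
Proof.
move=> Fg; rewrite -(groupMl _ (hol_prod1_norm_lift tau 0%R (tau (subg F g)))).
rewrite -hol_prod_split; apply: (subsetP (normG _)).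
by apply/liftP; exists 0%R, (subg F g); rewrite subgK.
Qed.

(** [F] is the projection of the lift to [Hol(E)]. *)
Lemma norm_lift_sub tau : 'N_H(lift_group tau) \subset hol_embed p @* 'N(F).
Proof.
apply/subsetP => _ /setIP[/morphimP[g _ _ ->] /normP nG].
apply: mem_morphim; rewrite ?inE //; apply/subsetP => _ /imsetP[f Ff ->].
have : hol_prod 0%R (tau (subg F f)) f ^ hol_embed p g \in lift_group tau.
  rewrite -nG memJ_conjg; apply/liftP; exists 0%R, (subg F f).
  by rewrite subgK.
by rewrite hol_prod_embedJ => /liftP[m [f' /hol_prod_inj[_ _ ->]]]; apply: subgP.
Qed.

(** The right conjugation [x ^ y = y^-1 * x * y] by [nu] is the inverse of
    [Phi nu], hence sends the graph of [tau] to that of [tau o Phi_nu]. *)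
Lemma lift_conj_aut tau tau' nu :
    Hol 1 nu \in 'N(F) ->
    (forall f : subg_of F, tau' f = tau (subg F (Phi nu (sgval f)))) ->
  lift_group tau :^ hol_embed p (Hol 1 nu) = lift_group tau'.
Proof.
move=> nF tau'E; apply/eqP; rewrite eqEsubset; apply/andP; split.
  apply/subsetP => _ /imsetP[x /liftP[m [f ->]] ->]; apply/liftP.
  have Ff : sgval f ^ Hol 1 nu \in F by rewrite memJ_norm ?subgP.
  exists m, (subg F (sgval f ^ Hol 1 nu)).
  by rewrite hol_prod_embedJ tau'E subgK // Phi_conjg sgvalK.
apply/subsetP => _ /liftP[m [f ->]].
have Ff : Phi nu (sgval f) \in F.
  by move: nF; rewrite -Phi_norm => /eqP <-; apply: imset_f; apply: subgP.
rewrite -[sgval f](conjg_Phi nu) -hol_prod_embedJ memJ_conjg tau'E.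
by apply/liftP; exists m, (subg F (Phi nu (sgval f))); rewrite subgK.
Qed.

Lemma ghom_Phi_exists tau nu : Hol 1 nu \in 'N(F) ->
  exists tau' : ghom {unit 'Z_p} F,
    forall f : subg_of F, tau' f = tau (subg F (Phi nu (sgval f))).
Proof.
move=> nF; have PhiF (f : subg_of F) : Phi nu (sgval f) \in F.
  by move: nF; rewrite -Phi_norm => /eqP <-; apply: imset_f; apply: subgP.
pose t := [ffun f : subg_of F => tau (subg F (Phi nu (sgval f)))].
have tM : morphic [set: subg_of F] t.
  apply/morphicP => f g _ _; rewrite !ffunE -ghomM; congr (tau _).
  by rewrite -[sgval (f * g)]/(sgval f * sgval g) PhiM subgM ?PhiF.
by exists (Ghom tM) => f; rewrite /= ffunE.
Qed.

(** An element of ['N(F)] is the product of an element of [F], whose copy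
    normalises the lift of [tau], and of an automorphism of [E]. *)
Lemma lift_norm_class tau : hol_regular F ->
  lift_group tau :^: (hol_embed p @* 'N(F)) =
  [set (lift_group tau' : {set _}) | tau' in [set t | ghom_simeq t tau]].
Proof.
move=> F_regular; apply/setP => X; apply/imsetP/imsetP.
  case=> _ /morphimP[g _ nFg ->] ->.
  have [f Ff [nu def_g]] := transitive_factor F_regular g.
  have nFnu : Hol 1 nu \in 'N(F).
    by move: nFg; rewrite def_g groupMl // (subsetP (normG F)).
  have [tau' tau'E] := ghom_Phi_exists tau nFnu.
  exists tau'; last first.
    rewrite def_g morphM ?inE // conjsgM.
    by rewrite (normP (hol_embed_norm_lift tau Ff)) (lift_conj_aut _ (tau' := tau')).
  rewrite inE; apply/existsP; exists nu; rewrite Phi_norm nFnu /=.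
  by apply/forallP => h; rewrite tau'E.
case=> tau'; rewrite inE => /existsP[nu /andP[]]; rewrite Phi_norm => nFnu.
move=> /forallP tau'E ->; exists (hol_embed p (Hol 1 nu)).
  exact: mem_morphim.
by rewrite (lift_conj_aut _ (tau' := tau')) // => f; apply/eqP/tau'E.
Qed.

Lemma lift_class tau : prime p -> ~~ (p %| #|[set: E]|)%N ->
  lift_group tau :^: [set: hol ('Z_p * E)%type] = lift_group tau :^: H.
Proof.
move=> p_prime pE; apply/eqP; rewrite eqEsubset andbC imsetS ?subsetT //=.
apply/subsetP => _ /imsetP[h _ ->].
have [m [u [g ->]]] := hol_prod_surj p_prime pE h.
rewrite hol_prod_split conjsgM (normP (hol_prod1_norm_lift tau m u)).
by apply: imset_f; apply: mem_morphim; rewrite inE.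
Qed.

End Lift.

(** * The length of the conjugacy class *)

Theorem corollary5 (p n : nat) (p_prime : prime p) (n_gt0 : (0 < n)%N)
  (p_ndvd_n : ~~ (p %| n)%N)
  (normal_p : forall gT : finGroupType, #|[set: gT]| = (n * p)%N ->
     exists P : {group gT}, (P <| [set: gT]) /\ #|P| = p)
  (E : finGroupType) (card_E : #|[set: E]| = n)
  (F : {group hol E}) (F_regular : hol_regular F)
  (tau : ghom {unit 'Z_p} F) :
  #|lift_group tau :^: [set: hol ('Z_p * E)%type]| =
  (#|F :^: [set: hol E]|
     * #|[set tau' : ghom {unit 'Z_p} F | ghom_simeq tau' tau]|)%N.
Proof.
rewrite lift_class ?card_E // -(card_imset _ (@lift_inj p E F)).
rewrite -lift_norm_class // !card_conjugates setTI.
pose H := (hol_embed p @* [set: hol E])%G; pose M := (hol_embed p @* 'N(F))%G.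
have sMH : M \subset H by apply: morphimS; apply: subsetT.
have sNM : 'N_H(lift_group tau) \subset M by apply: norm_lift_sub.
have eqN : 'N_M(lift_group tau) = 'N_H(lift_group tau).
  by apply/eqP; rewrite eqEsubset setSI //= subsetI sNM subsetIr.
have <- : #|H : M| = #|[set: hol E] : 'N(F)|.
  by rewrite index_injm ?injm_hol_embed ?subsetT.
by rewrite -/M -/H [X in (_ * #|_ : X|)%N]eqN Lagrange_index.
Qed.
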